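(* Let $p$ be a ZSD with increasing price function $P:\mathbb{N}_{\ge 1}\to\mathbb{R}_{\ge 0}$, short-distance price $P_S\in\mathbb{R}_{\ge 0}$ and bounds $S_{\max}\in\mathbb{N}_{\ge 1}\cup\{\infty\}$, $L_{\max}\in\mathbb{R}_{>0}\cup\{\infty\}$, at least one of them finite. Consider the following algorithm for two stations $x,y\in V$: let $W_1$ be a shortest (with respect to $l$) $x$-$y$-path with $s(W_1)\le S_{\max}$ and $l(W_1)\le L_{\max}$ if one exists (computed by a Bellman–Ford algorithm bounded by $S_{\max}$ iterations), and None otherwise; let $W_2$ be a shortest $x$-$y$-path with respect to the zone border weights $b$; return $W_1$ if $W_1\ne$ None and $P_S<P(z(W_2))$, and return $W_2$ otherwise. (i) The algorithm computes a cheapest path from $x$ to $y$ and hence a cheapest standard ticket in polynomial time. (ii) If $p$ satisfies the no-stopover property, then the algorithm yields a cheapest ticket from $x$ to $y$ (the standard ticket of the returned path) in polynomial time.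
   Context: ''Increasing'' means non-decreasing. A PTN is a finite, simple, connected, undirected graph $(V,E)$ with positive edge lengths. A path is a finite sequence $(x_1,\dots,x_n)$, $n\ge 1$, of (not necessarily distinct) nodes with consecutive nodes adjacent; $\mathcal{W}$ is the set of all paths; $l(W)$ is the sum of the edge lengths along $W$; $s(W)$ is the number of stations of $W$ except the start station, i.e. its number of edges; $[x_i,x_j]$ denotes the subpath $(x_i,\dots,x_j)$. A zone partition is a partition of $V$ into nonempty zones. The zone border weight of an edge is $b(e)=0$ if its endpoints lie in the same zone and $1$ otherwise; $z(W)=1+\sum_{i=1}^{n-1} b(x_i,x_{i+1})$ for $W=(x_1,\dots,x_n)$. A path $W$ is a short-distance path if $s(W)\le S_{\max}$ and $l(W)\le L_{\max}$. The ZSD (combination of a basic zone tariff with a short-distance tariff) is the fare structure with $p(W)=\min\{P_S,P(z(W))\}$ if $W$ is a short-distance path and $p(W)=P(z(W))$ otherwise. As a convention, $P_S<P(k)$ for all sufficiently large $k\in\mathbb{N}_{\ge 1}$. No-stopover property: $p([x_1,x_n])\le p([x_1,x_i])+p([x_i,x_n])$ for all paths $(x_1,\dots,x_n)\in\mathcal{W}$, $n\ge 3$, $2\le i\le n-1$. A ticket of $W\in\mathcal{W}$ is a finite sequence of paths $T=(H_1,\dots,H_t)$ such that $W$ is a concatenation $W_1+\dots+W_t$ of subpaths with $W_j$ a subpath of $H_j$ for each $j$; its price is $\sum_{j=1}^t p(H_j)$. The standard ticket of $W$ is $(W)$. A cheapest ticket (resp. cheapest standard ticket) from $x$ to $y$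 is one of minimum price among all tickets (resp. standard tickets) of all $x$-$y$-paths; a cheapest path from $x$ to $y$ is an $x$-$y$-path $W$ minimizing $p(W)$. *)

(* Defs.v *)
(* MathComp, with the real numbers of MathComp-Analysis (realType). *)
From mathcomp Require Import all_boot all_order all_algebra.
From mathcomp Require Import reals.

Set Implicit Arguments.
Unset Strict Implicit.
Unset Printing Implicit Defensive.

Import Order.TTheory GRing.Theory Num.Theory.
Local Open Scope ring_scope.

(* The values of [len] on non-adjacent pairs are irrelevant. *)
Record ptn (R : realType) := Ptn {
  station :> finType;
  adj : rel station;
  adj_sym : symmetric adj;
  adj_irr : irreflexive adj;
  adj_conn : forall x y : station, connect adj x y;
  len : station -> station -> R;
  len_sym : forall x y : station, adj x y -> len x y = len y x;
  len_gt0 : forall x y : station, adj x y -> 0 < len x y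
}.

(* Only the values [price k] with [1 <= k] matter; in the two bounds, [None]
   stands for infinity. *)
Record zsd (R : realType) := Zsd {
  price : nat -> R;
  sd_price : R;
  max_stops : option nat;
  max_len : option R
}.

Section Paths.
Variables (R : realType) (N : ptn R) (Z : {set {set N}}) (F : zsd R).
Implicit Types (x y : N) (W : seq N).

Definition is_path W : bool := if W is x :: p then path (@adj R N) x p else false.

Definition is_xy_path x y W : bool :=
  [&& is_path W, head x W == x & last x W == y].

Definition steps W : seq (N * N) := zip W (behead W).

Definition path_len W : R := \sum_(e <- steps W) len e.1 e.2.

Definition stops W : nat := size (steps W).

Definition border x y : nat := if pblock Z x == pblock Z y then 0%N else 1%N.

Definition border_weight W : nat := (\sum_(e <- steps W) border e.1 e.2)%N.

Definition zones W : nat := (1 + border_weight W)%N.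

Definition stops_ok n : bool := if max_stops F is Some k then (n <= k)%N else true.

Definition len_ok (d : R) : bool := if max_len F is Some L then d <= L else true.

Definition short_distance W : bool := stops_ok (stops W) && len_ok (path_len W).

Definition fare W : R :=
  if short_distance W then Num.min (sd_price F) (price F (zones W))
  else price F (zones W).

(* The subpath from the i-th to the j-th node, counted from 1. *)
Definition subpath W i j : seq N := drop i.-1 (take j W).

Definition no_stopover : Prop :=
  forall W i, is_path W -> (3 <= size W)%N -> (2 <= i <= (size W).-1)%N ->
    fare (subpath W 1 (size W)) <= fare (subpath W 1 i) + fare (subpath W i (size W)).

(* [is_concat Ws W] : W = W_1 + ... + W_t for Ws = [:: W_1; ...; W_t], t >= 1,
   where consecutive summands share the node at which they are glued. *)
Inductive is_concat : seq (seq N) -> seq N -> Prop :=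
| concat_one W : is_concat [:: W] W
| concat_cons x p q Ws :
    is_concat Ws (last x p :: q) -> is_concat ((x :: p) :: Ws) (x :: p ++ q).

Definition is_ticket W (T : seq (seq N)) : Prop :=
  all is_path T /\
  exists Ws, [/\ all is_path Ws, is_concat Ws W & all2 (fun Wj Hj => infix Wj Hj) Ws T].

Definition standard_ticket W : seq (seq N) := [:: W].

Definition ticket_price (T : seq (seq N)) : R := \sum_(H <- T) fare H.

Definition cheapest_path x y W : Prop :=
  is_xy_path x y W /\ forall W', is_xy_path x y W' -> fare W <= fare W'.

Definition cheapest_standard_ticket x y (T : seq (seq N)) : Prop :=
  (exists2 W, is_xy_path x y W & T = standard_ticket W) /\
  forall W', is_xy_path x y W' ->
    ticket_price T <= ticket_price (standard_ticket W').

Definition cheapest_ticket x y (T : seq (seq N)) : Prop :=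
  (exists2 W, is_xy_path x y W & is_ticket W T) /\
  forall W' T', is_xy_path x y W' -> is_ticket W' T' ->
    ticket_price T <= ticket_price T'.

Definition is_sd_shortest x y (o : option (seq N)) : Prop :=
  match o with
  | Some W =>
      is_xy_path x y W && short_distance W /\
      forall W', is_xy_path x y W' && short_distance W' -> path_len W <= path_len W'
  | None => forall W, ~ (is_xy_path x y W && short_distance W)
  end.

Definition is_border_shortest x y W : Prop :=
  is_xy_path x y W /\
  forall W', is_xy_path x y W' -> (border_weight W <= border_weight W')%N.

(* The possible results of the algorithm, shortest paths not being unique. *)
Definition algorithm_result x y W : Prop :=
  exists (W1 : option (seq N)) (W2 : seq N),
    [/\ is_sd_shortest x y W1, is_border_shortest x y W2 &
      W = if W1 is Some U then (if sd_price F < price F (zones W2) then U else W2)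
          else W2].

End Paths.

(* Running times are counted on a unit-cost real RAM: a value of type [cost A]
   is a result together with the number of elementary operations spent.  One
   unit is charged for each arithmetic operation or comparison on numbers, each
   evaluation of [price], each access to the input (adjacency, lengths, zone of
   a station, bounds), each array read or write, each list cons, and each loop
   iteration or recursive call. *)
Definition cost (A : Type) : Type := (A * nat)%type.

Definition ret A (a : A) : cost A := (a, 0%N).

Definition charge A (n : nat) (a : A) : cost A := (a, n).

Definition tick A (a : A) : cost A := charge 1 a.

Definition bind A B (m : cost A) (f : A -> cost B) : cost B :=
  ((f m.1).1, (m.2 + (f m.1).2)%N).

Notation "'let*' x := m 'in' f" := (bind m (fun x => f))
  (at level 200, x name, m at level 100, f at level 200, right associativity).

Fixpoint for_each A B (s : seq A) (f : B -> A -> cost B) (b : B) : cost B :=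
  if s is a :: s' then
    let* _ := tick tt in
    let* b' := f b a in
    for_each s' f b'
  else ret b.

Fixpoint repeat A (k : nat) (f : A -> cost A) (a : A) : cost A :=
  if k is k'.+1 then
    let* _ := tick tt in
    let* a' := f a in
    repeat k' f a'
  else ret a.

Section Algorithm.
Variables (R : realType) (N : ptn R) (Z : {set {set N}}) (F : zsd R).

(* The label of v : the best known v-y-path and its weight, y being fixed. *)
Definition label : Type := option (R * seq N).
Definition table : Type := {ffun N -> label}.

Definition new_table : cost table := charge #|N| [ffun=> None].

Definition read (D : table) (v : N) : cost label := tick (D v).

Definition write (D : table) (v : N) (a : label) : cost table :=
  tick [ffun u => if u == v then a else D u].

Definition len_cost (u v : N) : cost R := tick (len u v).

Definition border_cost (u v : N) : cost nat :=
  let* zu := tick (pblock Z u) in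
  let* zv := tick (pblock Z v) in
  tick (if zu == zv then 0%N else 1%N).

Definition border_costR (u v : N) : cost R :=
  let* c := border_cost u v in tick c%:R.

Definition bf_relax (w : N -> N -> cost R) (D : table) (v : N) (best : label) (u : N) :
    cost label :=
  let* vu := tick (adj v u) in
  if ~~ vu then ret best else
  let* Du := read D u in
  if Du is Some (d, p) then
    let* c := w v u in
    let* d' := tick (c + d) in
    let* better := tick (if best is Some (d0, _) then d' < d0 else true) in
    if better then
      let* p' := tick (v :: p) in ret (Some (d', p'))
    else ret best
  else ret best.

(* The new labels are computed from those of the previous round only, so that
   after k rounds the labels refer to shortest paths with at most k edges. *)
Definition bf_round (w : N -> N -> cost R) (D : table) : cost table :=
  let* D0 := new_table in
  for_each (enum N) (fun D' v =>
    let* old := read D v in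
    let* best := for_each (enum N) (bf_relax w D v) old in
    write D' v best) D0.

Definition bellman_ford (w : N -> N -> cost R) (k : nat) (x y : N) : cost label :=
  let* D := new_table in
  let* D := write D y (Some (0, [:: y])) in
  let* D := repeat k (bf_round w) D in
  read D x.

(* Rounds beyond |V| - 1 are useless since edge weights are nonnegative. *)
Definition sd_rounds : cost nat :=
  let* n := tick #|N|.-1 in
  let* S := tick (max_stops F) in
  if S is Some k then tick (minn k n) else ret n.

Definition compute_W1 (x y : N) : cost (option (seq N)) :=
  let* k := sd_rounds in
  let* r := bellman_ford len_cost k x y in
  if r is Some (d, p) then
    let* L := tick (max_len F) in
    let* ok := tick (if L is Some L0 then d <= L0 else true) in
    ret (if ok then Some p else None)
  else ret None.

Definition compute_W2 (x y : N) : cost (option (seq N)) :=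
  let* k := tick #|N|.-1 in
  let* r := bellman_ford border_costR k x y in
  ret (if r is Some (_, p) then Some p else None).

Fixpoint count_zones (u : N) (p : seq N) : cost nat :=
  if p is v :: p' then
    let* _ := tick tt in
    let* c := border_cost u v in
    let* k := count_zones v p' in
    tick (c + k)%N
  else tick 1%N.

Definition zsd_algorithm (x y : N) : cost (option (seq N)) :=
  let* W1 := compute_W1 x y in
  let* W2 := compute_W2 x y in
  match W1, W2 with
  | Some U, Some (u :: p) =>
      let* k := count_zones u p in
      let* Pk := tick (price F k) in
      let* sd := tick (sd_price F < Pk) in
      ret (if sd then W1 else W2)
  | _, _ => ret W2
  end.

End Algorithm.

(* Main.v *)
Require Import Defs.
From mathcomp Require Import all_boot all_order all_algebra.
From mathcomp Require Import reals.
From mathcomp Require Import zify.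

Import Order.TTheory GRing.Theory Num.Theory.
Local Open Scope ring_scope.

Set Implicit Arguments.
Unset Strict Implicit.
Unset Printing Implicit Defensive.

(** Optimality (algorithm_result_cheapest).  Let W2 use the fewest zones.
    Since prices increase with the number of zones, no fare is below
    min(P_S, P(z(W2))), and a path that is not short-distance costs at least
    P(z(W2)).  If a short-distance path U exists and P_S < P(z(W2)), then U
    attains the lower bound P_S, because P(z(U)) >= P(z(W2)) > P_S; otherwise
    W2 attains the bound P(z(W2)).

    Tickets (ticket_fare).  The fare never increases when passing to a subpath
    (fare_infix): a subpath has no more stops, length or border
    crossings, so it stays short-distance if the whole path was.  Hence the
    tickets H_j of a decomposition W = W_1 + ... + W_t cost at least the sum
    of the p(W_j), and iterating the no-stopover property (fare_concat) bounds
    that sum below by p(W).  So no ticket beats the cheapest standard ticket.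

    The algorithm (zsd_algorithm_correct).  After k rounds of Bellman-Ford
    the label of v is a lightest v-y-path among those with at most k edges
    (bellman_ford_lightest).  Cutting loops out of a path increases neither its
    weight, for nonnegative weights, nor its number of edges, and leaves at
    most |V| - 1 edges (cut_loops).  Hence min(S_max, |V| - 1) rounds see a
    shortest path with at most S_max stops, which is short-distance exactly
    when some short-distance path exists, and |V| - 1 rounds suffice for the
    border weights; there a label exists because the network is connected.

    Running time (zsd_algorithm_cost).  A round scans all pairs of stations
    and there are fewer than |V| rounds, so the total is cubic in |V|. *)

(** * Loops with a step counter *)

Lemma for_each_ind A B (I : seq A -> B -> Prop) (f : B -> A -> cost B) s b :
  I [::] b ->
  (forall s' a b', I s' b' -> I (rcons s' a) (f b' a).1) ->
  I s (for_each s f b).1.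
Proof.
move=> I0 Istep; rewrite -[X in I X _]/([::] ++ s).
elim: s [::] b I0 => [|a s IH] s' b Ib /=; first by rewrite cats0.
by rewrite -cat_rcons; apply/IH/Istep.
Qed.

Lemma for_each_cost A B (f : B -> A -> cost B) c s b :
  (forall b' a, (f b' a).2 <= c)%N ->
  ((for_each s f b).2 <= size s * c.+1)%N.
Proof.
move=> fc; elim: s b => //= a s IH b.
by move: (IH (f b a).1) (fc b a); rewrite mulSn; lia.
Qed.

Lemma repeat_ind A (I : nat -> A -> Prop) k (f : A -> cost A) a :
  I 0%N a -> (forall i b, I i b -> I i.+1 (f b).1) -> I k (repeat k f a).1.
Proof.
move=> I0 Istep; rewrite -[X in I X _]/(0 + k)%N.
elim: k 0%N a I0 => [|k IH] i a Ia /=; first by rewrite addn0.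
by rewrite addnS -addSn; apply/IH/Istep.
Qed.

Lemma repeat_cost A k (f : A -> cost A) c a :
  (forall b, (f b).2 <= c)%N -> ((repeat k f a).2 <= k * c.+1)%N.
Proof.
move=> fc; elim: k a => //= k IH a.
by move: (IH (f a).1) (fc a); rewrite mulSn; lia.
Qed.

(** * Weights of paths and their subpaths *)

Section Walks.
Variables (R : realType) (N : ptn R).
Implicit Types (x y u v : N) (W H : seq N).

Lemma stops_cons x p : stops (x :: p) = size p.
Proof. by rewrite /stops /steps size_zip; apply/minn_idPr. Qed.

Lemma adj_steps W e : is_path W -> e \in steps W -> adj e.1 e.2.
Proof.
case: W => // x p; elim: p x => [|z p IH] x //= /andP[xz zp].
rewrite /steps /= inE => /orP[/eqP -> //|]; exact: (IH z zp).
Qed.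

(** Everything measured along a path is a sum over its steps, so this one fact
    makes stops, length and border weight monotone under taking subpaths. *)
Lemma steps_infix W H : infix W H -> infix (steps W) (steps H).
Proof.
case/infixP => s1 [s2 ->]; apply: (@infix_trans _ (steps (W ++ s2))).
- apply/prefixW; elim: W => [|a [|b W] IH]; try exact: prefix0s.
  by rewrite /steps /= eqxx.
- elim: s1 => [|a s1 IH]; first exact: infix_refl.
  rewrite cat_cons; apply: infix_trans IH _.
  case: (s1 ++ W ++ s2) => [|b s] //; exact: infix_cons.
Qed.

Lemma stops_infix W H : infix W H -> (stops W <= stops H)%N.
Proof. by move/steps_infix/size_infix. Qed.

Section Weights.
Variable w : N -> N -> R.
Hypothesis w_ge0 : forall u v, adj u v -> 0 <= w u v.

Definition path_weight W : R := \sum_(e <- steps W) w e.1 e.2.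

Lemma path_weight_cons x z p :
  path_weight (x :: z :: p) = w x z + path_weight (z :: p).
Proof. by rewrite /path_weight /steps /= big_cons. Qed.

Lemma path_weight_infix W H :
  is_path H -> infix W H -> path_weight W <= path_weight H.
Proof.
move=> pH /steps_infix/infixP[s1 [s2 eH]].
have w0 e : e \in steps H -> 0 <= w e.1 e.2.
  by move=> eH'; apply/w_ge0/(adj_steps pH).
rewrite /path_weight eH !big_cat /= addrCA lerDl.
by rewrite addr_ge0 // big_seq sumr_ge0 // => e es; apply: w0;
  rewrite eH !mem_cat es ?orbT.
Qed.

(** Induction on the path: a loop-free replacement of the tail either avoids
    the new first node x, or passes through x and is then cut down to its part
    from x on. *)
Lemma cut_loops_uniq x p : path (@adj R N) x p ->
  exists q, [/\ path (@adj R N) x q, last x q = last x p, uniq (x :: q),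
    (size q <= size p)%N & path_weight (x :: q) <= path_weight (x :: p)].
Proof.
elim: p x => [|z p IH] x; first by move=> _; exists [::]; split.
rewrite [path _ _ _]/= => /andP[xz /IH[q [pq lq uq sq wq]]].
have w_zp : path_weight (z :: p) <= path_weight (x :: z :: p).
  by rewrite path_weight_cons lerDr w_ge0.
have [xq|xq] := boolP (x \in z :: q); last first.
  exists (z :: q); split=> //=; first by rewrite xz.
    by rewrite xq.
  by rewrite !path_weight_cons lerD2l.
(* The tail comes back to x: drop everything before that visit. *)
have [q1 [q2 eq_zq]] : exists q1 q2, z :: q = q1 ++ x :: q2.
  by case/splitPr: xq => q1 q2; exists q1, q2.
have inf : infix (x :: q2) (z :: q) by rewrite eq_zq -[_ ++ _]cats0 -catA infix_infix.
exists q2; split.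
- have: is_path (q1 ++ x :: q2) by rewrite -eq_zq.
  by case: q1 {eq_zq} => //= a q1; rewrite cat_path => /= /and3P[].
- by transitivity (last x (z :: q)); [rewrite eq_zq last_cat | exact: lq].
- by move: uq; rewrite eq_zq cat_uniq => /and3P[].
- by move: (stops_infix inf); rewrite !stops_cons /=; lia.
- exact: le_trans (le_trans (path_weight_infix (pq : is_path (z :: q)) inf) wq) w_zp.
Qed.

(** A path without repeated nodes has at most |V| - 1 edges.  The bound by the
    stops of W matters as well: it keeps the limit on stops satisfied. *)
Lemma cut_loops x y W : is_xy_path x y W ->
  exists W', [/\ is_xy_path x y W', (stops W' <= stops W)%N,
    (stops W' <= #|N|.-1)%N & path_weight W' <= path_weight W].
Proof.
case: W => // a p /and3P[/= pp /eqP<- /eqP <-].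
have [q [pq lq uq sq wq]] := cut_loops_uniq pp.
exists (a :: q); split=> //.
- by apply/and3P; split=> //=; rewrite lq.
- by rewrite !stops_cons.
- by rewrite stops_cons; move: (max_card (mem (a :: q))); rewrite (card_uniqP uq) /=; lia.
Qed.

(** * Correctness and cost of the Bellman-Ford algorithm *)

(** What a Bellman-Ford label asserts once the search has taken exactly the
    paths of C into account. *)
Definition lightest (C : pred (seq N)) (a : label N) : Prop :=
  if a is Some (d, p) then
    [/\ C p, d = path_weight p & forall W, C W -> d <= path_weight W]
  else forall W, ~~ C W.

Definition walks_upto k v y : pred (seq N) :=
  fun W => is_xy_path v y W && (stops W <= k)%N.

Lemma eq_lightest C C' a : C =1 C' -> lightest C a -> lightest C' a.
Proof.
move=> eC; case: a => [[d p] [Cp -> min]|none] /=; last by move=> W; rewrite -eC.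
by split=> [||W]; rewrite -?eC //; exact: min.
Qed.

Section BellmanFord.
Variable wc : N -> N -> cost R.
Hypothesis wcE : forall u v, (wc u v).1 = w u v.

(** C is meant to consist of paths from u, so that a new first node v gives
    paths again. *)
Definition extensions v u (C : pred (seq N)) : pred (seq N) :=
  fun W => if W is a :: W' then [&& a == v, adj v u & C W'] else false.

(** Relaxing along v-u compares the current candidate with v followed by the
    best path from u; as prefixing the same edge preserves the order of
    weights, this is the best among all extensions of paths from u. *)
Lemma bf_relax_lightest C (D : table N) k y v best u :
  lightest (walks_upto k u y) (D u) -> lightest C best ->
  lightest (predU C (extensions v u (walks_upto k u y)))
           (bf_relax wc D v best u).1.
Proof.
(* The relaxation reads D only at u, so that D can be made constant and
   its value there generalized. *)
have -> : bf_relax wc D v best u = bf_relax wc [ffun=> D u] v best u.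
  by rewrite /bf_relax /read ffunE.
move: (D u) => Du; rewrite /bf_relax /read ffunE /=; case: ifP => [/negPf nadj _|/negbFE vu].
  by rewrite /=; apply: eq_lightest => -[|a W] /=; rewrite ?nadj ?andbF orbF.
case: Du => [[d p]|] /=; last first.
  by move=> none; apply: eq_lightest => -[|a W] /=; rewrite ?(negPf (none _)) ?andbF orbF.
case=> Cp -> minp Cbest.
have ext W : extensions v u (walks_upto k u y) W -> w v u + path_weight p <= path_weight W.
  case: W => // a [|b W] /and3P[/eqP-> _ CW] //; rewrite path_weight_cons.
  have/eqP bu : b == u by case/andP: (CW) => /and3P[].
  by rewrite bu lerD2l -bu minp.
have pE : path_weight (v :: p) = w v u + path_weight p.
  case: p Cp {minp ext} => // b p /andP[/and3P[_ /= /eqP-> _] _].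
  exact: path_weight_cons.
have Evp : extensions v u (walks_upto k u y) (v :: p) by rewrite /= eqxx vu.
rewrite wcE; case: best Cbest => [[d0 p0]|] /=.
  case=> Cp0 -> min0; case: ltP => [lt|le] /=.
    split=> [||W /orP[/min0|/ext]] //; first by apply/orP; right.
    exact/le_trans/ltW.
  split=> [||W /orP[/min0|/ext]] //; first by apply/orP; left.
  exact: le_trans.
move=> none; split=> [||W /orP[|/ext]] //; first by apply/orP; right.
by rewrite (negPf (none W)).
Qed.

(** A path with at most k+1 edges has at most k edges or is an edge v-u
    followed by a path with at most k edges.  The inner loop therefore
    maintains optimality among the paths with at most k edges together with
    those of at most k+1 edges whose second node has been scanned. *)
Lemma bf_round_lightest k y (D : table N) :
  (forall v, lightest (walks_upto k v y) (D v)) ->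
  forall v, lightest (walks_upto k.+1 v y) ((bf_round wc D).1 v).
Proof.
move=> lD v.
pose I (s : seq N) (D' : table N) :=
  forall v, v \in s -> lightest (walks_upto k.+1 v y) (D' v).
suff: I (enum N) (bf_round wc D).1 by apply; rewrite mem_enum.
apply: (@for_each_ind _ _ I) => // s {}v D' ID' u.
rewrite mem_rcons inE ffunE; case: eqP => [-> _|_ us]; last exact: ID'.
(* nth v W 1 is the second node of W; its default value is harmless since
   the one-node path already has at most k edges. *)
pose J (s : seq N) (best : label N) := lightest (fun W =>
  is_xy_path v y W && (stops W <= k.+1)%N &&
  ((stops W <= k)%N || (nth v W 1 \in s))) best.
have: J (enum N) ((for_each (enum N) (bf_relax wc D v) (D v)).1 : label N).
  apply: (@for_each_ind _ _ J) => [|s' z best Jb].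
    apply: eq_lightest _ (lD v) => W; rewrite /walks_upto in_nil orbF -andbA.
    by case: (is_xy_path v y W) => //=; lia.
  apply: eq_lightest _ (bf_relax_lightest v (lD z) Jb) => W.
  rewrite mem_rcons inE /= /walks_upto /is_xy_path.
  case: W => [|a [|b W]] //=; first by rewrite !andbF !orbF.
  rewrite !stops_cons /= ltnS; case: (a =P v) => [->|_]; rewrite ?andbF ?orbF //=.
  case: (b =P z) => [->|_]; rewrite ?andbF ?orbF ?andbT //=.
  case: (adj v z) => //=; rewrite ?andbF //.
  case: (path _ z W) => //=; case: (last z W == y) => //=; lia.
by apply: eq_lightest => W; rewrite mem_enum orbT andbT.
Qed.

Lemma bellman_ford_lightest k x y :
  lightest (walks_upto k x y) (bellman_ford wc k x y).1.
Proof.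
pose I k (D : table N) := forall v, lightest (walks_upto k v y) (D v).
apply: (@repeat_ind _ I) => [v|i D lD v]; last exact: bf_round_lightest.
rewrite /= !ffunE; case: eqP => [->|/eqP vy].
  have w1 : path_weight [:: y] = 0 by rewrite /path_weight big_nil.
  split=> [||[|a [|b p]]] //; rewrite ?w1 //.
    by rewrite /walks_upto /is_xy_path /= !eqxx.
    by rewrite /path_weight big_nil.
  by rewrite /walks_upto stops_cons andbF.
move=> [|a [|b p]] //; last by rewrite /walks_upto stops_cons andbF.
apply/negP => /andP[/and3P[_ /= /eqP-> /eqP av] _].
by rewrite av eqxx in vy.
Qed.

Lemma bf_round_cost c D : (forall u v, (wc u v).2 <= c)%N ->
  ((bf_round wc D).2 <= #|N| * (#|N| * (c + 6) + 4))%N.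
Proof.
move=> wcc.
have relax v best u : ((bf_relax wc D v best u).2 <= c + 5)%N.
  rewrite /bf_relax /=; case: ifP => _ /=; first by lia.
  move: (wcc v u) => wvu; case: (fun_of_fin _ _) => [[d p]|] /=; last by lia.
  by case: ifP => _ /=; lia.
rewrite /bf_round /=.
have inner (D' : table N) v : ((let* old := read D v in
    let* best := for_each (enum N) (bf_relax wc D v) old in
    write D' v best).2 <= #|N| * (c + 6) + 2)%N.
  have := for_each_cost (enum N) (D v) (relax v).
  by rewrite -cardE /= !cardT -!cardE; lia.
have outer := for_each_cost (enum N) [ffun=> None] inner.
apply: leq_trans (leq_add (leqnn _) outer) _; rewrite -cardE.
by move: (_ * (c + 6))%N => t; rewrite -mulnS leq_mul2l; lia.
Qed.

Lemma bellman_ford_cost c k x y : (forall u v, (wc u v).2 <= c)%N ->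
  ((bellman_ford wc k x y).2 <= #|N| + 2 + k * (#|N| * (#|N| * (c + 6) + 4)).+1)%N.
Proof.
move=> wcc; rewrite /bellman_ford /=; set rounds := repeat _ _ _.
have : (rounds.2 <= _)%N := repeat_cost k _ (fun D => bf_round_cost D wcc).
by move: (k * _)%N => t; lia.
Qed.

End BellmanFord.

End Weights.
End Walks.

(** * The two path searches and the complete algorithm *)

Section Algorithm.
Variables (R : realType) (N : ptn R) (Z : {set {set N}}) (F : zsd R).
Implicit Types (x y u v : N) (W H : seq N).

Let border_w u v : R := (border Z u v)%:R.

Lemma len_ge0 u v : adj u v -> 0 <= len u v.
Proof. by move/len_gt0/ltW. Qed.

Lemma border_ge0 u v : adj u v -> 0 <= border_w u v.
Proof. by rewrite ler0n. Qed.

(** The search for W2 computes with real labels, whereas border weights are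
    natural numbers. *)
Lemma border_path_weight W : path_weight border_w W = (border_weight Z W)%:R.
Proof. by rewrite /border_weight natr_sum. Qed.

Lemma short_distance_lighter W W' : (stops W <= stops W')%N ->
  path_len W <= path_len W' -> short_distance F W' -> short_distance F W.
Proof.
rewrite /short_distance /stops_ok /len_ok => sWW' lWW' /andP[sW' lW'].
apply/andP; split.
  by case: (max_stops F) sW' => // k; exact: leq_trans.
by case: (max_len F) lW' => // L; exact: le_trans.
Qed.

Lemma sd_rounds_stops_ok W : stops_ok F (stops W) -> (stops W <= #|N|.-1)%N ->
  (stops W <= (sd_rounds N F).1)%N.
Proof.
rewrite /stops_ok /sd_rounds /=.
by case: (max_stops F) => //= k; rewrite leq_min => -> ->.
Qed.

Lemma stops_ok_sd_rounds n : (n <= (sd_rounds N F).1)%N -> stops_ok F n.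
Proof.
rewrite /stops_ok /sd_rounds /=.
by case: (max_stops F) => //= k; rewrite leq_min => /andP[].
Qed.

(** The rounds enforce the limit on stops, but the limit on length is tested
    only for the shortest path found: if that one is too long, so is every
    path within the limit on stops. *)
Lemma compute_W1_correct x y : is_sd_shortest F x y (compute_W1 F x y).1.
Proof.
have cut W : is_xy_path x y W && short_distance F W ->
    exists2 W', walks_upto (sd_rounds N F).1 x y W' & path_len W' <= path_len W.
  case/andP=> /(cut_loops len_ge0)[W' [xyW' sW' nW' lW']] sdW.
  exists W' => //; rewrite /walks_upto xyW' sd_rounds_stops_ok //.
  by case/andP: (short_distance_lighter sW' lW' sdW).
have := bellman_ford_lightest (w := @len R N) (wc := @len_cost R N)
  (fun _ _ => erefl) (sd_rounds N F).1 x y.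
rewrite /compute_W1 /bind.
case: (bellman_ford _ _ _ _).1 => [[d p]|] /=; last first.
  by move=> none W /cut[W' CW' _]; move: (none W'); rewrite CW'.
case=> /andP[xyp sp] dE min.
have [ok|nok] := boolP (len_ok F d).
  rewrite /len_ok in ok; rewrite ok /=; split.
    rewrite xyp /short_distance stops_ok_sd_rounds //.
    by rewrite /len_ok -[path_len p]dE ok.
  move=> W /cut[W' CW' lW']; rewrite -[path_len p]dE.
  exact: le_trans (min _ CW') lW'.
rewrite /len_ok in nok; rewrite (negPf nok) /= => W sdW.
have [W' CW' lW'] := cut W sdW.
case/andP: sdW => _ /andP[_]; rewrite /len_ok.
case: (max_len F) nok => //= L /negP dL lWL; apply: dL.
exact: le_trans (min _ CW') (le_trans lW' lWL).
Qed.

Lemma compute_W2_correct x y : exists W,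
  [/\ (compute_W2 Z x y).1 = Some W, is_border_shortest Z x y W &
      (stops W <= #|N|.-1)%N].
Proof.
have cut W : is_xy_path x y W ->
    exists2 W', walks_upto #|N|.-1 x y W' & path_weight border_w W' <= path_weight border_w W.
  move/(cut_loops border_ge0) => [W' [xyW' _ nW' wW']].
  by exists W' => //; rewrite /walks_upto xyW'.
have := bellman_ford_lightest (w := border_w) (wc := border_costR Z)
  (fun _ _ => erefl) #|N|.-1 x y.
rewrite /compute_W2 /bind.
case: (bellman_ford _ _ _ _).1 => [[d p]|] /=; last first.
  move=> none; have /connectP[q xq yE] := adj_conn x y.
  have [|W' CW' _] := cut (x :: q); first by apply/and3P; rewrite /= xq -yE.
  by move: (none W'); rewrite CW'.
case=> /andP[xyp sp] dE min; exists p; split=> //; split=> // W /cut[W' CW' wW'].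
by move: (le_trans (min _ CW') wW'); rewrite dE !border_path_weight ler_nat.
Qed.

Lemma count_zones_correct u p :
  (count_zones Z u p).1 = zones Z (u :: p) /\
  (count_zones Z u p).2 = (5 * size p + 1)%N.
Proof.
elim: p u => [|v p IH] u /=; first by rewrite /zones /border_weight big_nil.
have [-> ->] := IH v; split; last by lia.
by rewrite /zones /border_weight /steps /= big_cons addnCA.
Qed.

Lemma zsd_algorithm_correct x y :
  exists2 W, (zsd_algorithm Z F x y).1 = Some W & algorithm_result Z F x y W.
Proof.
have W1P := compute_W1_correct x y.
have [W2 [W2E W2P _]] := compute_W2_correct x y.
rewrite /zsd_algorithm; case: (compute_W1 F x y) W1P => W1 m1 UP.
case: (compute_W2 Z x y) W2E => o2 m2 /= ->; case: W1 UP => [U|] /= UP.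
  case: W2 W2P => [|u p] W2P; first by case: W2P.
  exists (if sd_price F < price F (zones Z (u :: p)) then U else u :: p).
    by rewrite /= (count_zones_correct u p).1; case: ifP.
  by exists (Some U), (u :: p).
by exists W2 => //; exists None, W2.
Qed.

(** Two searches of at most 17 |V|^3 operations each, plus the linear cost of
    counting the zones of W2; 50 leaves room for the lower-order terms. *)
Lemma zsd_algorithm_cost x y : ((zsd_algorithm Z F x y).2 <= 50 * #|N| ^ 3)%N.
Proof.
have n_gt0 : (0 < #|N|)%N by apply/card_gt0P; exists x.
have nM : (#|N| <= #|N| ^ 3)%N by rewrite -[leqLHS]expn1 leq_pexp2l.
move: nM; set M := (#|N| ^ 3)%N => nM; have M_gt0 := leq_trans n_gt0 nM.
have [W2 [W2E W2P sW2]] := compute_W2_correct x y.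
have bf c (wc : N -> N -> cost R) k : (forall u v, (wc u v).2 <= c)%N ->
    (c <= 4)%N -> (k <= #|N|.-1)%N ->
    ((bellman_ford wc k x y).2 <= 17 * M)%N.
  move=> wcc c4 kn; apply: leq_trans (bellman_ford_cost k x y wcc) _.
  apply: (@leq_trans (#|N| + 2 + #|N|.-1 * (#|N| * (#|N| * (4 + 6) + 4)).+1)).
    by rewrite leq_add2l leq_mul // ltnS leq_mul2l leq_add2r leq_mul2l; lia.
  rewrite /M; case: #|N| n_gt0 => // n _; rewrite !expnS expn0 /=; nia.
have kn : ((sd_rounds N F).1 <= #|N|.-1)%N.
  by rewrite /sd_rounds /=; case: (max_stops F) => //= k; rewrite geq_minr.
have k3 : ((sd_rounds N F).2 <= 3)%N.
  by rewrite /sd_rounds /=; case: (max_stops F).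
have c1 : ((compute_W1 F x y).2 <= 17 * M + 5)%N.
  have := bf 1%N (@len_cost R N) _ (fun _ _ => leqnn _) isT kn.
  move: k3; rewrite /compute_W1 /bind; set r := bellman_ford _ _ _ _.
  move: r (sd_rounds N F) => -[o m] k /=; case: o => [[d p]|] /=; lia.
have c2 : ((compute_W2 Z x y).2 <= 17 * M + 1)%N.
  have := bf 4%N (border_costR Z) _ (fun _ _ => leqnn _) isT (leqnn _).
  rewrite /compute_W2 /bind; set r := bellman_ford _ _ _ _.
  move: r => -[o m] /=; case: o => [[d p]|] /=; lia.
have c3 u p : W2 = u :: p -> ((count_zones Z u p).2 <= 5 * M)%N.
  move=> W2E'; apply: (@leq_trans (5 * #|N|)); last by rewrite leq_mul2l nM orbT.
  rewrite (count_zones_correct u p).2.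
  by move: sW2; rewrite W2E' stops_cons; lia.
rewrite /zsd_algorithm; case: (compute_W1 F x y) c1 => W1 m1 c1.
case: (compute_W2 Z x y) W2E c2 => o2 m2 /= -> c2.
move: M nM M_gt0 c1 c2 c3 {bf k3} => M; case: W1 => [U|] /= nM M_gt0 c1 c2 c3; last by lia.
case: W2 {W2P sW2} c3 => [|u p] c3 /=; first by lia.
move: (c3 u p erefl); move: (count_zones Z u p).2 => m3 c3M; lia.
Qed.

(** * Fares, cheapest paths and tickets *)

Hypothesis price_ge0 : forall k, (1 <= k)%N -> 0 <= price F k.
Hypothesis price_mono :
  forall i j, (1 <= i)%N -> (i <= j)%N -> price F i <= price F j.
Hypothesis sd_price_ge0 : 0 <= sd_price F.

Lemma fare_ge0 W : 0 <= fare Z F W.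
Proof. by rewrite /fare; case: ifP => _; rewrite ?le_min ?sd_price_ge0 price_ge0. Qed.

Lemma fare_infix W H : is_path H -> infix W H -> fare Z F W <= fare Z F H.
Proof.
move=> pH WH; have zWH : price F (zones Z W) <= price F (zones Z H).
  apply: price_mono => //; rewrite leq_add2l.
  by have := path_weight_infix border_ge0 pH WH; rewrite !border_path_weight ler_nat.
have sdWH : short_distance F H -> short_distance F W.
  exact: short_distance_lighter (stops_infix WH) (path_weight_infix len_ge0 pH WH).
rewrite /fare; have [/sdWH -> |_] := boolP (short_distance F H).
  by rewrite le_min2 ?lexx.
by case: ifP => // _; rewrite ge_min zWH orbT.
Qed.

Lemma algorithm_result_cheapest x y W :
  algorithm_result Z F x y W -> cheapest_path Z F x y W.
Proof.
case=> W1 [W2 [W1P [xyW2 minW2] ->]].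
have zW2 W' : is_xy_path x y W' -> price F (zones Z W2) <= price F (zones Z W').
  by move=> xyW'; apply: price_mono => //; rewrite leq_add2l minW2.
have fareW2 : fare Z F W2 <= price F (zones Z W2).
  by rewrite /fare; case: ifP => // _; rewrite ge_min lexx orbT.
(* With no short-distance path at all, every fare is the zone price. *)
case: W1 W1P => [U|] W1P; last first.
  split=> // W' xyW'; apply: le_trans fareW2 _; rewrite /fare.
  by case: ifP => [sdW'|_]; [case: (W1P W'); rewrite xyW' | exact: zW2].
have fare_lb W' : is_xy_path x y W' ->
    Num.min (sd_price F) (price F (zones Z W2)) <= fare Z F W'.
  move=> xyW'; rewrite /fare; case: ifP => _.
    by rewrite le_min2 ?zW2.
  by rewrite ge_min zW2 ?orbT.
case: ltP => PS; split=> [|W' xyW'].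
- by case: W1P => /andP[].
- case: W1P => /andP[_ sdU] _; apply: le_trans (fare_lb _ xyW').
  by rewrite /fare sdU (min_l (ltW PS)) ge_min lexx.
- exact: xyW2.
by apply: le_trans fareW2 _; rewrite -(min_r PS); exact: fare_lb.
Qed.

(** The no-stopover property only speaks of proper inner stops.  When a summand
    is a single node, the concatenation equals the other summand, and
    nonnegativity of the fares suffices. *)
Lemma fare_concat W Ws : no_stopover Z F -> is_concat Ws W -> all (@is_path R N) Ws ->
  is_path W /\ fare Z F W <= \sum_(V <- Ws) fare Z F V.
Proof.
move=> ns; elim=> {W Ws} [W /andP[pW _]|x p q Ws _ IH /= /andP[xp /IH[pq fq]]].
  by rewrite big_seq1.
have pW : is_path (x :: p ++ q) by rewrite /= cat_path xp.
split=> //; rewrite big_cons; apply: le_trans (_ : _ <= fare Z F (x :: p) + fare Z F (last x p :: q)) _.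
  2: by rewrite lerD2l.
case: p {IH} xp pq fq pW => [|a p] xp pq fq pW; first by rewrite lerDr fare_ge0.
case: q pq fq pW => [|b q] pq fq pW; first by rewrite cats0 lerDl fare_ge0.
have splitW : x :: (a :: p) ++ b :: q = belast x (a :: p) ++ last x (a :: p) :: b :: q.
  by rewrite -[RHS]cat_rcons -lastI.
have := ns _ (size (x :: a :: p)) pW; rewrite /subpath take_size drop0.
have -> : take (size (x :: a :: p)) (x :: (a :: p) ++ b :: q) = x :: a :: p.
  by rewrite -cat_cons take_size_cat.
have -> : drop (size (x :: a :: p)).-1 (x :: (a :: p) ++ b :: q)
    = last x (a :: p) :: b :: q.
  by rewrite splitW drop_size_cat // size_belast.
by rewrite drop0; apply; rewrite /= size_cat /=; lia.
Qed.

(** Each ticket costs at least the part of W travelled on it, and these parts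
    together cost at least W. *)
Lemma ticket_fare W T : no_stopover Z F -> is_ticket W T ->
  fare Z F W <= ticket_price Z F T.
Proof.
move=> ns [pT [Ws [pWs WsW]]] WsT.
apply: le_trans (fare_concat ns WsW pWs).2 _; rewrite /ticket_price.
elim: Ws T pT WsT {pWs WsW} => [|V Ws IH] [|H T] //=.
case/andP=> pH pT /andP[VH WsT]; rewrite !big_cons lerD ?fare_infix //.
exact: IH.
Qed.

Lemma standard_ticketP W : is_path W -> is_ticket W (standard_ticket W).
Proof.
move=> pW; split; first by rewrite /= pW.
by exists [:: W]; rewrite /= pW infix_refl; split=> //; exact: concat_one.
Qed.

Lemma standard_ticket_price W : ticket_price Z F (standard_ticket W) = fare Z F W.
Proof. exact: big_seq1. Qed.

End Algorithm.

Theorem corollary59 :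
  exists q : {poly nat},
  forall (R : realType) (N : ptn R) (Z : {set {set N}}) (F : zsd R)
    (hZ : partition Z [set: N])
    (hP0 : forall k, (1 <= k)%N -> 0 <= price F k)
    (hPincr : forall i j, (1 <= i)%N -> (i <= j)%N -> price F i <= price F j)
    (hPS0 : 0 <= sd_price F)
    (hS : forall k, max_stops F = Some k -> (1 <= k)%N)
    (hL : forall L, max_len F = Some L -> 0 < L)
    (hSL : max_stops F <> None \/ max_len F <> None)
    (hPS : exists k0, forall k, (1 <= k)%N -> (k0 <= k)%N -> sd_price F < price F k)
    (x y : N),
  [/\ exists2 W, (zsd_algorithm Z F x y).1 = Some W & algorithm_result Z F x y W,
      ((zsd_algorithm Z F x y).2 <= q.[#|N|])%N,
      forall W, algorithm_result Z F x y W ->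
        cheapest_path Z F x y W /\
        cheapest_standard_ticket Z F x y (standard_ticket W) &
      no_stopover Z F ->
      forall W, algorithm_result Z F x y W ->
        cheapest_ticket Z F x y (standard_ticket W)].
Proof.
exists (50%N *: 'X^3) => R N Z F _ P_ge0 P_mono PS_ge0 _ _ _ _ x y; split.
- exact: zsd_algorithm_correct.
- by rewrite hornerZ hornerXn; exact: zsd_algorithm_cost.
- move=> W /(algorithm_result_cheapest P_mono) cheap; split=> //.
  case: cheap => xyW minW; split; first by exists W.
  by move=> W' /minW; rewrite !standard_ticket_price.
move=> ns W /(algorithm_result_cheapest P_mono)[xyW minW]; split.
  by exists W => //; apply: standard_ticketP; case/and3P: xyW.
move=> W' T /minW leWW' /(ticket_fare P_ge0 P_mono PS_ge0 ns); rewrite standard_ticket_price.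
exact: le_trans.
Qed.
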